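(* For every Coxeter element $w\in S_n$, the tangent cone $\mathcal{T}_w$ of the Schubert variety $\mathcal{X}_w$ at the standard flag $F_0$ is given by the equations $$x_{ij}=0\qquad\text{for } i-j>1 .$$
   Context: $\mathcal{F}$ is the variety of complete flags $V_0\subset V_1\subset\cdots\subset V_n=\mathbb{C}^n$, $\dim V_k=k$; $\varepsilon_1,\dots,\varepsilon_n$ is the standard basis, $F_0$ the standard flag $V_k=\langle\varepsilon_1,\dots,\varepsilon_k\rangle$, $B$ the group of upper-triangular matrices in $\mathrm{GL}(n,\mathbb{C})$. For $w\in S_n$, $\mathcal{X}_w$ is the closure of the $B$-orbit of the flag $V_k=\langle\varepsilon_{w(1)},\dots,\varepsilon_{w(k)}\rangle$; it contains $F_0$. Near $F_0$, flags are in bijection with lower unitriangular $n\times n$ matrices $X=(x_{ij})$ ($V_k$ is the span of the first $k$ columns of $X$), so the $x_{ij}$, $i>j$, are local coordinates centred at $F_0$ and coordinates on $T_{F_0}\mathcal{F}$. The tangent cone $\mathcal{T}_w\subset T_{F_0}\mathcal{F}$ is the set of vectors tangent to $\mathcal{X}_w$ at $F_0$, i.e. the common zero set of the lowest-degree homogeneous parts of the polynomials in the $x_{ij}$ vanishing on $\mathcal{X}_w$ in this chart. A Coxeter element of $S_n$ is an element of length $n-1$ of the form $w=s_{i_1}s_{i_2}\cdots s_{i_{n-1}}$ in which every elementary transposition $s_i=(i\ i{+}1)$, $1\le i\le n-1$, occurs exactly once. *)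

(* Defs.v *)
From HB Require Import structures.
From mathcomp Require Import all_boot all_order all_fingroup all_algebra.
From mathcomp Require Import reals.
From mathcomp Require Import complex mpoly.

Set Implicit Arguments.
Unset Strict Implicit.
Unset Printing Implicit Defensive.

Import Order.TTheory GRing.Theory Num.Theory.
Local Open Scope ring_scope.

(* All indices start from 0: the basis vector e_(i+1), the row or column i+1
   and the letter s_(i+1) are indexed by i. *)

Section Coxeter.

Variable n : nat.

Lemma ord_pred_ltn (i : 'I_n.-1) : (i < n)%N.
Proof. exact: leq_trans (ltn_ord i) (leq_pred n). Qed.

Lemma ord_predS_ltn (i : 'I_n.-1) : (i.+1 < n)%N.
Proof. by rewrite -ltn_predRL ltn_ord. Qed.

Definition simple_transp (i : 'I_n.-1) : 'S_n :=
  tperm (Ordinal (ord_pred_ltn i)) (Ordinal (ord_predS_ltn i)).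

(* [(u * v)%g x = v (u x)] in MathComp, whereas the product s_i1 s_i2 ... is a
   composition of maps, in which the rightmost factor acts first. *)
Definition word_perm (s : seq 'I_n.-1) : 'S_n :=
  foldr (fun i u => (u * simple_transp i)%g) 1%g s.

Definition has_length (w : 'S_n) (l : nat) : Prop :=
  (exists s, size s = l /\ w = word_perm s) /\
  (forall s, w = word_perm s -> (l <= size s)%N).

Definition is_coxeter (w : 'S_n) : Prop :=
  has_length w n.-1 /\
  exists s, (forall i, count_mem i s = 1%N) /\ w = word_perm s.

End Coxeter.

Section FlagVariety.

Variables (K : fieldType) (n : nat).

Definition chain := {ffun 'I_n.+1 -> {vspace 'cV[K]_n}}.

Definition is_flag (V : chain) : Prop :=
  (forall k, \dim (V k) = k) /\
  (forall k l : 'I_n.+1, (k <= l)%N -> (V k <= V l)%VS).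

Definition flag_of (g : 'M[K]_n) : chain :=
  [ffun k : 'I_n.+1 => (\sum_(j < n | (j < k)%N) <[col j g]>)%VS].

Definition basis_vec (i : 'I_n) : 'cV[K]_n := delta_mx i 0.

Definition coord_flag (w : 'S_n) : chain :=
  [ffun k : 'I_n.+1 => (\sum_(j < n | (j < k)%N) <[basis_vec (w j)]>)%VS].

Definition borel (b : 'M[K]_n) : Prop :=
  b \in unitmx /\ forall i j : 'I_n, (j < i)%N -> b i j = 0.

Definition act (b : 'M[K]_n) (V : chain) : chain :=
  [ffun k => (linfun (mulmx b) @: V k)%VS].

Definition borel_orbit (V0 V : chain) : Prop :=
  exists2 b, borel b & V = act b V0.

Definition eval_entries (p : {mpoly K[n * n]}) (g : 'M[K]_n) : K :=
  p.@[fun k => mxvec g 0 k].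

(* The Zariski topology of the flag variety GL_n / B is the quotient topology:
   a set of flags is closed iff the invertible matrices g with [flag_of g] in
   it form a Zariski closed subset of GL_n. *)
Definition zariski_closed (Z : chain -> Prop) : Prop :=
  exists I : {mpoly K[n * n]} -> Prop, forall g : 'M[K]_n, g \in unitmx ->
    (Z (flag_of g) <-> forall p, I p -> eval_entries p g = 0).

Definition zariski_closure (O : chain -> Prop) (V : chain) : Prop :=
  is_flag V /\
  forall Z, zariski_closed Z -> (forall U, is_flag U -> O U -> Z U) -> Z V.

Definition schubert (w : 'S_n) : chain -> Prop :=
  zariski_closure (borel_orbit (coord_flag w)).

(* The index set of the coordinates x_ij, i > j. *)
Definition lowpos := {p : 'I_n * 'I_n | (p.2 < p.1)%N}.

(* A family (x_ij), i > j, is both a point of the chart centred at the standard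
   flag and a tangent vector at that flag. *)
Definition coords := {ffun lowpos -> K}.

Definition chart_mx (x : coords) : 'M[K]_n :=
  \matrix_(i, j) if insub (i, j) is Some p then x p else (i == j)%:R.

Definition chart (x : coords) : chain := flag_of (chart_mx x).

Definition coord_poly := {mpoly K[#|{: lowpos}|]}.

Definition eval_coords (p : coord_poly) (x : coords) : K :=
  p.@[fun k => x (enum_val k)].

Definition is_lowest_form (p q : coord_poly) : Prop :=
  exists d, [/\ q = pihomog mdeg d p, q != 0 &
                forall e, (e < d)%N -> pihomog mdeg e p = 0].

Definition vanishes_on_schubert (w : 'S_n) (p : coord_poly) : Prop :=
  forall y, schubert w (chart y) -> eval_coords p y = 0.

Definition tangent_cone (w : 'S_n) (x : coords) : Prop :=
  forall p q, vanishes_on_schubert w p -> is_lowest_form p q ->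
    eval_coords q x = 0.

End FlagVariety.

(* Main.v *)
Require Import Defs.
From mathcomp Require Import all_boot all_order all_fingroup all_algebra.
From mathcomp Require Import reals.
From mathcomp Require Import complex mpoly.

Set Implicit Arguments.
Unset Strict Implicit.
Unset Printing Implicit Defensive.

Import Order.TTheory GRing.Theory Num.Theory.
Local Open Scope ring_scope.

(** Indices start from 0; [F_k] is the span of the first [k] basis vectors.
    A Coxeter element is a product [w] of the [s_i] in some order, each used
    once; both inclusions come from reading that order.

    The cone is contained in the linear space.  Fix [j] and compare the places
    of [s_j] and [s_(j+1)] in the word of [w].  The letter [s_b] is the only one
    that can move a point across the gap between [b] and [b+1], so
    - if [s_j] stands to the left of [s_(j+1)], then [w] maps [0..j] into
      [0..j+1], hence [V_(j+1)] lies in [F_(j+2)] for every flag [V] of the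
      Schubert variety, and [x_ij] itself vanishes there for [i > j+1];
    - if [s_(j+1)] stands to the left, then [w^-1] maps [0..j] into [0..j+1],
      hence [V_(j+2)] contains [F_(j+1)]; in the chart this says
      [x_ij = x_(j+1,j) * x_(i,j+1)] for [i > j+1].
    Both incidence conditions are closed and stable under the Borel group, so it
    is enough to test them on the coordinate flag of [w] ([schubert_sub_std],
    [schubert_std_sub]).  In both cases the linear part is [x_ij]
    ([schubert_equation]).

    The linear space is contained in the cone.  For a word [s_i1 ... s_im] of
    distinct letters and nonzero [t_i], the product of the lower elementary
    matrices [1 + t_i E_(i+1,i)], taken in the order of the word, lies in the
    Bruhat cell [B w B] ([word_mx_bruhat]): appending a new letter on the left
    always increases the length.  This product is lower unitriangular, and
    modulo terms of degree 2 in [t] its entries are the [t_i] on the first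
    subdiagonal and 0 below it.  Letting each [t_i] be [a_i T], or [T^2] when
    [a_i = 0], gives a curve in the Schubert variety with tangent vector [a] at
    the standard flag ([tangent_curve]).  A polynomial vanishing along the curve
    has a lowest form vanishing at [a] ([lowest_form_curve]). *)

(** * Flags, incidence conditions and Schubert varieties *)

Section Flags.

Variables (K : fieldType) (n : nat).
Implicit Types (g h b : 'M[K]_n) (U : chain K n) (w : 'S_n).

Lemma mulmx_coords g (c : 'cV[K]_n) : g *m c = \sum_j c j 0 *: col j g.
Proof.
apply/colP=> i; rewrite mxE summxE; apply: eq_bigr => j _.
by rewrite !mxE mulrC.
Qed.

(** [invmx g *m v] lists the coordinates of [v] in the basis formed by the columns
    of [g].  This turns every incidence between flags into the vanishing of
    matrix entries. *)
Lemma memv_flag_of g (k : 'I_n.+1) (v : 'cV[K]_n) : g \in unitmx ->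
  reflect (forall l : 'I_n, (k <= l)%N -> (invmx g *m v) l 0 = 0)
          (v \in flag_of g k).
Proof.
move=> gu; rewrite ffunE; apply: (iffP memv_sumP) => [[u hu ->] l lek|hv].
  rewrite mulmx_sumr summxE big1 // => j ltjk.
  have /vlineP[c ->] := hu j ltjk.
  rewrite -scalemxAr colE mulmxA mulVmx // mul1mx !mxE andbT.
  by case: eqP => [e|]; [rewrite -e ltnNge lek in ltjk | rewrite mulr0].
exists (fun j => (invmx g *m v) j 0 *: col j g) => [j _|].
  by rewrite memvZ // memv_line.
rewrite -{1}[v]mul1mx -(mulmxV gu) -mulmxA mulmx_coords.
rewrite (bigID (fun j : 'I_n => (j < k)%N)) /=.
by rewrite [X in _ + X]big1 ?addr0 // => j; rewrite -leqNgt => /hv->; rewrite scale0r.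
Qed.

Lemma flag_of_sub g h (k r : 'I_n.+1) : g \in unitmx ->
  (flag_of h k <= flag_of g r)%VS <->
  (forall j l : 'I_n, (j < k)%N -> (r <= l)%N -> (invmx g *m h) l j = 0).
Proof.
move=> gu; rewrite [flag_of h k]ffunE; split.
  move=> /subv_sumP sub j l ltjk lerl.
  have := sub j ltjk; rewrite -memvE => /(memv_flag_of _ _ gu)/(_ l lerl).
  by rewrite colE mulmxA -colE mxE.
move=> h0; apply/subv_sumP => j ltjk; rewrite -memvE.
apply/(memv_flag_of _ _ gu) => l lerl.
by rewrite colE mulmxA -colE mxE h0.
Qed.

Lemma is_flag_flag_of g : g \in unitmx -> is_flag (flag_of g).
Proof.
move=> gu; split=> [k|k l lekl].
  have /directvP/= dV : directv (\sum_(j < n | (j < k)%N) <[col j g]>).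
    apply/directv_sum_independent => u hu u0 i ltik.
    pose c : 'cV[K]_n := \col_j (if (j < k)%N then (invmx g *m u j) j 0 else 0).
    have uE (j : 'I_n) : (j < k)%N -> u j = c j 0 *: col j g.
      move=> ltjk; have /vlineP[d du] := hu j ltjk.
      rewrite mxE ltjk du -scalemxAr colE mulmxA mulVmx // mul1mx !mxE !eqxx.
      by rewrite mulr1.
    have : g *m c = 0.
      rewrite mulmx_coords -[RHS]u0 [RHS]big_mkcond /=; apply: eq_bigr => j _.
      by case: ifP => [/uE-> //|ltjk]; rewrite mxE ltjk scale0r.
    move/(congr1 (mulmx (invmx g))); rewrite mulmxA mulVmx // mul1mx mulmx0.
    by move=> c0; rewrite uE // c0 mxE scale0r.
  rewrite ffunE dV (eq_bigr (fun=> 1%N)) => [|j ltjk].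
    have lekn : (k <= n)%N by rewrite -ltnS.
    by rewrite (big_ord_narrow lekn) sum_nat_const card_ord muln1.
  rewrite dim_vline; case: eqP => // /(congr1 (mulmx (invmx g))).
  rewrite colE mulmxA mulVmx // mul1mx mulmx0 => /matrixP/(_ j 0).
  by rewrite !mxE !eqxx => /eqP; rewrite oner_eq0.
rewrite !ffunE; apply/subv_sumP => j ltjk.
by apply: sumv_sup (subvv _); apply: leq_trans ltjk lekl.
Qed.

Lemma borel_diag b (i : 'I_n) : borel b -> b i i != 0.
Proof.
case=> bu b0; have : is_trig_mx b^T.
  by apply/is_trig_mxP => j k ltjk; rewrite mxE b0.
move/det_trig; rewrite det_tr => db.
move: bu; rewrite unitmxE db unitfE prodf_seq_neq0 => /allP/(_ i).
by rewrite mem_index_enum mxE; apply.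
Qed.

Lemma borel1 : borel (1%:M : 'M[K]_n).
Proof. by split=> [|i j ltji]; rewrite ?unitmx1 // mxE -val_eqE /= gtn_eqF. Qed.

Lemma borelM b c : borel b -> borel c -> borel (b *m c).
Proof.
move=> [bu b0] [cu c0]; split=> [|i j ltji]; first by rewrite unitmx_mul bu.
rewrite mxE big1 // => k _; case: (ltnP k i) => [ltki|leik].
  by rewrite b0 // mul0r.
by rewrite [c _ _]c0 ?mulr0 // (leq_trans ltji).
Qed.

(** Upper triangular column operations preserve the spans of the first columns;
    by equality of dimensions, one inclusion suffices. *)
Lemma flag_of_mulr g b : g \in unitmx -> borel b ->
  flag_of (g *m b) = flag_of g.
Proof.
move=> gu [bu b0]; apply/ffunP => k; apply/eqP.
have [d1 _] : is_flag (flag_of (g *m b)).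
  by apply: is_flag_flag_of; rewrite unitmx_mul gu.
have [d2 _] := is_flag_flag_of gu.
rewrite eqEdim d1 d2 leqnn andbT; apply/flag_of_sub => // j l ltjk lekl.
by rewrite mulmxA mulVmx // mul1mx b0 // (leq_trans ltjk).
Qed.

Lemma actE b U k : Defs.act b U k = (linfun (mulmx b) @: U k)%VS.
Proof. by rewrite ffunE. Qed.

Lemma act_flag_of b g : Defs.act b (flag_of g) = flag_of (b *m g).
Proof.
apply/ffunP => k; rewrite !ffunE limg_sum; apply: eq_bigr => j _.
by rewrite limg_line lfunE /= !colE mulmxA.
Qed.

(** The inverse appears because [perm_mx s] acts on rows: [weyl_mx w] is the matrix
    that maps the basis vector [i] to the basis vector [w i]. *)
Definition weyl_mx w : 'M[K]_n := perm_mx w^-1.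

Lemma weyl_mxE w i j : weyl_mx w i j = (i == w j)%:R.
Proof. by rewrite !mxE -(inj_eq (@perm_inj _ w)) permKV. Qed.

Lemma coord_flagE w : coord_flag K w = flag_of (weyl_mx w).
Proof.
apply/ffunP => k; rewrite !ffunE; apply: eq_bigr => j _; congr <[_]>%VS.
by apply/colP => i; rewrite [RHS]mxE weyl_mxE mxE andbT.
Qed.

Lemma weyl_mx_unit w : weyl_mx w \in unitmx.
Proof. exact: unitmx_perm. Qed.

Lemma invmx_weyl w : invmx (weyl_mx w) = perm_mx w.
Proof.
rewrite -[LHS]mulmx1 -[1%:M](_ : weyl_mx w *m perm_mx w = _).
  by rewrite mulmxA mulVmx ?weyl_mx_unit // mul1mx.
by rewrite -perm_mxM mulVg perm_mx1.
Qed.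

Lemma schubert_flag_of w g b b' : borel b -> borel b' ->
  g = b *m weyl_mx w *m b' -> schubert w (flag_of g).
Proof.
move=> Bb Bb' ->; have [bu _] := Bb; have [b'u _] := Bb'.
have wu := weyl_mx_unit w.
have fE : flag_of (b *m weyl_mx w *m b') = Defs.act b (coord_flag K w).
  by rewrite flag_of_mulr // ?unitmx_mul ?bu // coord_flagE act_flag_of.
have ff : is_flag (flag_of (b *m weyl_mx w *m b')).
  by apply: is_flag_flag_of; rewrite !unitmx_mul bu wu.
by split=> // Z _; apply => //; exists b.
Qed.

Lemma zariski_closed_sub_std (k r : 'I_n.+1) :
  zariski_closed (fun U => (U k <= flag_of (1%:M : 'M[K]_n) r)%VS).
Proof.
exists (fun p => exists j l : 'I_n,
  [/\ (j < k)%N, (r <= l)%N & p = 'X_(mxvec_index l j)]).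
move=> g _; split=> [/(flag_of_sub _ _ _ (unitmx1 _ _)) sub p [j [l [ltjk lerl ->]]]|g0].
  by rewrite /eval_entries mevalXU mxvecE -(sub j l) // invmx1 mul1mx.
apply/(flag_of_sub _ _ _ (unitmx1 _ _)) => j l ltjk lerl.
by rewrite invmx1 mul1mx -mxvecE -mevalXU; apply: g0; exists j, l.
Qed.

(** On invertible matrices, the entries of the inverse vanish together with the
    entries of the adjugate, which are polynomial. *)
Lemma zariski_closed_std_sub (k r : 'I_n.+1) :
  zariski_closed (fun U => (flag_of (1%:M : 'M[K]_n) k <= U r)%VS).
Proof.
pose G : 'M[{mpoly K[n * n]}]_n := \matrix_(i, j) 'X_(mxvec_index i j).
have adjE g l j : eval_entries (\adj G l j) g = (\adj g) l j.
  rewrite /eval_entries; set v := fun k => _.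
  have -> : \adj g = map_mx (meval v) (\adj G).
    rewrite map_mx_adj; congr (\adj _).
    by apply/matrixP => a c; rewrite !mxE /= mevalXU /v mxvecE.
  by rewrite [RHS]mxE.
exists (fun p => exists j l : 'I_n,
  [/\ (j < k)%N, (r <= l)%N & p = \adj G l j]).
move=> g gu.
have invE l j : ((invmx g *m 1%:M) l j == 0) = ((\adj g) l j == 0).
  have du : \det g != 0 by rewrite -unitfE -unitmxE.
  by rewrite mulmx1 /invmx gu mxE mulf_eq0 invr_eq0 (negPf du).
split=> [/(flag_of_sub _ _ _ gu) sub p [j [l [ltjk lerl ->]]]|g0].
  by apply/eqP; rewrite adjE -invE sub.
apply/(flag_of_sub _ _ _ gu) => j l ltjk lerl; apply/eqP; rewrite invE -adjE.
by apply/eqP/g0; exists j, l.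
Qed.

(** The condition is closed, and it holds on the whole Borel orbit as soon as it
    holds for the coordinate flag, because the Borel group fixes the standard
    flag. *)
Lemma schubert_sub_std w U (k r : 'I_n.+1) :
    (forall j : 'I_n, (j < k)%N -> (w j < r)%N) -> schubert w U ->
  (U k <= flag_of (1%:M : 'M[K]_n) r)%VS.
Proof.
move=> hw [_ /(_ _ (zariski_closed_sub_std k r))]; apply => V _ [b Bb ->].
have -> : flag_of (1%:M : 'M[K]_n) = Defs.act b (flag_of 1%:M).
  by rewrite act_flag_of mulmx1 -[b]mul1mx flag_of_mulr ?unitmx1.
rewrite !actE; apply: limgS; rewrite coord_flagE; apply/flag_of_sub.
  exact: unitmx1.
move=> j l /hw ltwr lerl; rewrite invmx1 mul1mx weyl_mxE.
by case: eqP => // e; rewrite -e ltnNge lerl in ltwr.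
Qed.

Lemma schubert_std_sub w U (k r : 'I_n.+1) :
    (forall j : 'I_n, (w j < k)%N -> (j < r)%N) -> schubert w U ->
  (flag_of (1%:M : 'M[K]_n) k <= U r)%VS.
Proof.
move=> hw [_ /(_ _ (zariski_closed_std_sub k r))]; apply => V _ [b Bb ->].
have -> : flag_of (1%:M : 'M[K]_n) = Defs.act b (flag_of 1%:M).
  by rewrite act_flag_of mulmx1 -[b]mul1mx flag_of_mulr ?unitmx1.
rewrite !actE; apply: limgS; rewrite coord_flagE; apply/flag_of_sub.
  exact: weyl_mx_unit.
move=> j l ltjk lerl; rewrite invmx_weyl mulmx1 !mxE.
by case: eqP => // e; move: ltjk; rewrite -e => /hw; rewrite ltnNge lerl.
Qed.

End Flags.

(** * Words in the simple transpositions *)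

Section Words.

Variable n : nat.
Implicit Types (a b i : 'I_n.-1) (s : seq 'I_n.-1) (x : 'I_n).

Lemma simple_transp_leq i b x : i != b ->
  (simple_transp i x <= b)%N = (x <= b)%N.
Proof.
move=> nib; have {}nib : nat_of_ord i <> b.
  by move/val_inj => e; rewrite e eqxx in nib.
rewrite /simple_transp; case: tpermP => [->|->|//] /=;
  by case: (ltngtP i b) nib => // /ltnW.
Qed.

(** Only the letter [b] exchanges a point of [0..b] with a point outside it. *)
Lemma word_perm_leq s b x : b \notin s ->
  (word_perm s x <= b)%N = (x <= b)%N.
Proof.
elim: s => [|i s IHs] /=; first by rewrite perm1.
rewrite inE negb_or => /andP[nbi nbs].
by rewrite permM simple_transp_leq ?IHs // eq_sym.
Qed.

Lemma word_perm_cat s1 s2 : word_perm (s1 ++ s2) = (word_perm s2 * word_perm s1)%g.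
Proof. by elim: s1 => [|i s1 IHs]; rewrite /= ?mulg1 // IHs mulgA. Qed.

(** Cut the word just before [b].  The left part does not contain [b], so it
    preserves [0..b]; the right part does not contain [a], so it preserves
    [0..a].  The right part acts first. *)
Lemma word_perm_before s a b x : uniq s -> a \in s -> b \in s ->
    (index a s < index b s)%N ->
  [/\ (a <= b)%N -> (x <= a)%N -> (word_perm s x <= b)%N &
      (b <= a)%N -> (word_perm s x <= b)%N -> (x <= a)%N].
Proof.
move=> us sa sb ltab; rewrite -(cat_take_drop (index b s) s) word_perm_cat permM.
have nb : b \notin take (index b s) s by rewrite in_take // ltnn.
have na : a \notin drop (index b s) s.
  move: us; rewrite -{1}(cat_take_drop (index b s) s) cat_uniq => /and3P[_ /hasPn d _].
  by apply/negP => /d; rewrite in_take // ltab.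
split=> leab; rewrite (word_perm_leq _ nb).
  by rewrite -(word_perm_leq _ na) => /leq_trans; apply.
by rewrite -(word_perm_leq x na) => /leq_trans; apply.
Qed.

End Words.

(** * The chart at the standard flag *)

Section Chart.

Variables (K : fieldType) (n : nat).
Implicit Types (y : coords K n) (p : lowpos n) (X : 'M[K]_n).

Lemma chart_mx_low y p : chart_mx y (val p).1 (val p).2 = y p.
Proof. by rewrite mxE -surjective_pairing valK. Qed.

Lemma chart_mx_up y (i j : 'I_n) : (i <= j)%N -> chart_mx y i j = (i == j)%:R.
Proof. by move=> leij; rewrite mxE insubF //= ltnNge leij. Qed.

Lemma unitri_unit X : (forall i j : 'I_n, (i <= j)%N -> X i j = (i == j)%:R) ->
  X \in unitmx.
Proof.
move=> X1; rewrite unitmxE det_trig.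
  by rewrite big1 ?unitr1 // => i _; rewrite X1 // eqxx.
by apply/is_trig_mxP => i j ltij; rewrite X1 ?(ltnW ltij) // -val_eqE /= ltn_eqF.
Qed.

Lemma chart_mx_unit y : chart_mx y \in unitmx.
Proof. exact/unitri_unit/chart_mx_up. Qed.

(** Forward substitution. *)
Lemma unitri_solve X (c : 'cV[K]_n) (m : nat) :
    (forall i j : 'I_n, (i <= j)%N -> X i j = (i == j)%:R) ->
    (forall l : 'I_n, (l < m)%N -> (X *m c) l 0 = 0) ->
  forall l : 'I_n, (l < m)%N -> c l 0 = 0.
Proof.
move=> X1 Xc0 l; have [k lek] := ubnP (val l).
elim: k l lek => // k IHk l; rewrite ltnS => lelk ltlm.
rewrite -(Xc0 l ltlm) mxE (bigD1 l) //= X1 // eqxx mul1r big1 ?addr0 // => j.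
rewrite -val_eqE /= neq_ltn => /orP[ltjl|ltlj].
  by rewrite IHk ?mulr0 //; [exact: leq_trans lelk | exact: ltn_trans ltlm].
by rewrite X1 ?(ltnW ltlj) // -val_eqE /= ltn_eqF // mul0r.
Qed.

(** The first [j+2] columns of the chart matrix [X] span the basis vector [e_j].
    By triangularity the combination must be
    [col j X - X j' j *: col j' X], and its row [i] gives the equation. *)
Lemma chart_std_sub y (k r : 'I_n.+1) (i j j' : 'I_n) :
    j' = j.+1 :> nat -> k = j.+1 :> nat -> r = j.+2 :> nat -> (j < i)%N ->
    (flag_of (1%:M : 'M[K]_n) k <= chart y r)%VS ->
  chart_mx y i j = chart_mx y j' j * chart_mx y i j'.
Proof.
set X := chart_mx y => ej' ek er ltji /(flag_of_sub _ _ _ (chart_mx_unit y)) sub.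
have Xu := chart_mx_unit y; have X1 := chart_mx_up y.
(* The coefficients of the expected combination minus the actual ones. *)
pose c := delta_mx j 0 - X j' j *: delta_mx j' 0 - col j (invmx X).
have XcE l : (X *m c) l 0 = X l j - X j' j * X l j' - (l == j)%:R.
  rewrite /c !mulmxBr -scalemxAr -!colE [col j (invmx X)]colE mulmxA mulmxV //.
  by rewrite mul1mx !mxE andbT.
have njj' : j != j' by rewrite -val_eqE /= ej' ltn_eqF.
have chigh (l : 'I_n) : (r <= l)%N -> c l 0 = 0.
  move=> lerl; have := sub j l; rewrite mulmx1 ek => /(_ (leqnn _) lerl) s0.
  have ltjl : (j' < l)%N by rewrite ej' -er.
  have nlj : (l == j) = false by rewrite -val_eqE /= gtn_eqF // -ltnS -ej' ltnW.
  have nlj' : (l == j') = false by rewrite -val_eqE /= gtn_eqF.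
  by rewrite !mxE s0 nlj nlj' mulr0 !subr0.
have clow : forall l : 'I_n, (l < r)%N -> c l 0 = 0.
  apply: (unitri_solve X1) => l; rewrite er !ltnS XcE leq_eqVlt => /orP[/eqP elj'|].
    have -> : l = j' by apply/val_inj; rewrite /= elj' ej'.
    by rewrite [X j' j']X1 // eqxx mulr1 subrr eq_sym (negPf njj') subr0.
  rewrite ltnS => lelj; rewrite [X l j]X1 // [X l j']X1 ?ej' ?(leqW lelj) //.
  by rewrite -[l == j']val_eqE /= ej' ltn_eqF ?ltnS // mulr0 subr0 subrr.
have c0 : c = 0.
  by apply/colP => l; case: (leqP r l) => [/chigh->|/clow->]; rewrite mxE.
have := XcE i; rewrite c0 mulmx0 mxE -val_eqE /= gtn_eqF // subr0.
by move/esym/eqP; rewrite subr_eq0 => /eqP.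
Qed.

End Chart.

(** * Lowest forms *)

Section LowestForms.

Variables (K : fieldType) (n : nat).

Lemma lowest_form_linear a (q : coord_poly K n) : q \is 2.-homog for mdeg ->
  is_lowest_form ('X_a - q) 'X_a.
Proof.
move=> hq; have hX : ('X_a : coord_poly K n) \is 1.-homog for mdeg.
  by rewrite dhomogX /= mdeg1.
exists 1%N; split.
- by rewrite raddfB /= pihomog_dE // (pihomog_ne0 _ hq) // subr0.
- by rewrite -msupp_eq0 msuppX.
- by case=> // _; rewrite raddfB /= (pihomog_ne0 _ hX) // (pihomog_ne0 _ hq) // subr0.
Qed.

End LowestForms.

Section Curves.

Variable K : numFieldType.

Lemma poly_vanish_punctured (p : {poly K}) :
  (forall t, t != 0 -> p.[t] = 0) -> p = 0.
Proof.
move=> p0; apply/eqP/negPn/negP => pn0.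
pose rs : seq K := [seq i.+1%:R | i <- iota 0 (size p)].
have := @max_poly_roots _ p rs pn0; rewrite size_map size_iota ltnn => imp.
suff: false by []; apply: imp.
  apply/allP => _ /mapP[i _ ->]; apply/rootP/p0.
  by rewrite pnatr_eq0.
rewrite map_inj_uniq ?iota_uniq // => i j /eqP.
by rewrite eqr_nat eqSS => /eqP.
Qed.

(** Along the curve [k |-> 'X * z k], a monomial of degree [m] contributes only to
    the coefficients of degree at least [m].  Since [p] has no monomial of degree
    below [d], the coefficient of degree [d] is the form of degree [d] evaluated
    at the tangent vector. *)
Lemma lowest_form_curve N (p : {mpoly K[N]}) d (z : 'I_N -> {poly K}) :
    (forall e, (e < d)%N -> pihomog mdeg e p = 0) ->
    (forall t, t != 0 -> p.@[fun k => ('X * z k).[t]] = 0) ->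
  (pihomog mdeg d p).@[fun k => (z k)`_0] = 0.
Proof.
move=> plow p0.
have lowm m : m \in msupp p -> (d <= mdeg m)%N.
  move=> pm; rewrite leqNgt; apply/negP => /plow /(congr1 (mcoeff m)).
  rewrite mcoeff0 pihomogE raddf_sum /= (big_rem m) //= eqxx mcoeffZ mcoeffX eqxx mulr1.
  rewrite big1_seq ?addr0 => [/eqP|m']; first by rewrite mcoeff_eq0 pm.
  rewrite mem_rem_uniq ?msupp_uniq // => /andP[_ /andP[/negPf nm _]].
  by rewrite mcoeffZ mcoeffX nm mulr0.
pose P := mmap polyC (fun k => 'X * z k) p.
have P0 : P = 0.
  apply: poly_vanish_punctured => t /p0; rewrite mevalE => <-.
  rewrite /P /mmap horner_sum; apply: eq_bigr => m _.
  rewrite hornerM hornerC; congr (_ * _).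
  by rewrite /mmap1 horner_prod; apply: eq_bigr => k _; rewrite horner_exp.
rewrite -[RHS](_ : P`_d = 0); last by rewrite P0 coef0.
rewrite /P /mmap coef_sum pihomogE raddf_sum /= big_mkcond /= big_seq [RHS]big_seq.
apply: eq_bigr => m /lowm ledm; rewrite coefCM.
have -> : mmap1 (fun k => 'X * z k) m = 'X^(mdeg m) * mmap1 z m.
  rewrite /mmap1 (eq_bigr (fun k => 'X ^+ m k * z k ^+ m k)) => [|k _]; last exact: exprMn.
  rewrite big_split /=; congr (_ * _).
  by rewrite mdegE prodrXr.
rewrite coefXnM; case: ltngtP ledm => // [ltdm _|-> _]; first by rewrite mulr0.
rewrite mevalZ mevalX subnn; congr (_ * _).
rewrite -horner_coef0 /mmap1 horner_prod; apply: eq_bigr => k _.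
by rewrite horner_exp horner_coef0.
Qed.

End Curves.

(** * Products of elementary matrices *)

Definition elem_mx (R : pzRingType) n (k l : 'I_n) (t : R) : 'M[R]_n :=
  1%:M + t *: delta_mx k l.

Definition ord_lo n (i : 'I_n.-1) : 'I_n := Ordinal (ord_pred_ltn i).
Definition ord_hi n (i : 'I_n.-1) : 'I_n := Ordinal (ord_predS_ltn i).

Definition word_mx (R : pzRingType) n (t : 'I_n.-1 -> R) (s : seq 'I_n.-1) :
    'M[R]_n :=
  foldr (fun i M => elem_mx (ord_hi i) (ord_lo i) (t i) *m M) 1%:M s.

Section ElementaryMatrices.

Variables (R : comPzRingType) (n : nat).

Lemma elem_mulmxE k l t (M : 'M[R]_n) i j :
  (elem_mx k l t *m M) i j = M i j + (i == k)%:R * (t * M l j).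
Proof.
rewrite /elem_mx mulmxDl mul1mx -scalemxAl !mxE; congr (_ + _).
rewrite mulrCA (bigD1 l) //= big1 => [|h /negPf nhl]; last by rewrite mxE nhl andbF mul0r.
by rewrite mxE eqxx andbT addr0.
Qed.

Lemma mulmx_elemE k l t (M : 'M[R]_n) i j :
  (M *m elem_mx k l t) i j = M i j + t * M i k * (j == l)%:R.
Proof.
rewrite /elem_mx mulmxDr mulmx1 -scalemxAr !mxE; congr (_ + _).
rewrite -mulrA (bigD1 k) //= big1 => [|h /negPf nhl]; last by rewrite mxE nhl mulr0.
by rewrite mxE eqxx addr0.
Qed.

Lemma elem_mxM k l t u : k != l ->
  elem_mx k l t *m elem_mx k l u = elem_mx k l (t + u) :> 'M[R]_n.
Proof.
move=> nkl; apply/matrixP => i j; rewrite elem_mulmxE !mxE [l == k]eq_sym (negPf nkl).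
case: (i == k) => /=; last by rewrite mul0r !mulr0 !addr0.
by rewrite mulr0 addr0 mul1r [l == j]eq_sym -addrA -mulrDl [u + t]addrC.
Qed.

Lemma word_mx_unitri t s (i j : 'I_n) : (i <= j)%N ->
  word_mx t s i j = (i == j)%:R :> R.
Proof.
elim: s i j => [|a s IHs] i j leij /=; first by rewrite mxE.
rewrite elem_mulmxE IHs //; case: (i =P ord_hi a) => [ei|_]; last by rewrite mul0r addr0.
have ltaj : (ord_lo a < j)%N by rewrite ei in leij.
by rewrite IHs ?(ltnW ltaj) // -[ord_lo a == j]val_eqE /= ltn_eqF // !mulr0 addr0.
Qed.

End ElementaryMatrices.

Lemma word_mx_map (R S : comPzRingType) (f : {rmorphism R -> S}) n
    (t : 'I_n.-1 -> R) s :
  map_mx f (word_mx t s) = word_mx (f \o t) s.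
Proof.
elim: s => [|a s IHs] /=; first by rewrite map_mx1.
by rewrite map_mxM IHs map_mxD map_mx1 map_mxZ map_delta_mx.
Qed.

(** Modulo ['X^2] the product of the factors [1 + 'X * c a *: E] is
    [1 + 'X * (the sum of the c a *: E)]. *)
Lemma word_mx_coef01 (R : comNzRingType) n (c : 'I_n.-1 -> {poly R}) s :
  (forall i j, (word_mx (fun a => 'X * c a) s i j)`_0 = (i == j)%:R) /\
  (forall i j, (word_mx (fun a => 'X * c a) s i j)`_1 =
     \sum_(a <- s | (i == ord_hi a) && (j == ord_lo a)) (c a)`_0).
Proof.
elim: s => [|a s IHs] /=.
  by split=> i j; rewrite ?big_nil mxE -polyCMn ?coefC.
case: IHs => M0 M1; split=> i j; rewrite elem_mulmxE coefD.
  by rewrite M0 coef0M -mulrA coefXM mulr0 addr0.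
rewrite M1 big_cons; case: (i =P ord_hi a) => _ /=; last by rewrite mul0r coef0 addr0.
rewrite mul1r -mulrA coefXM /= coef0M M0 [j == _]eq_sym.
by case: (_ == j); rewrite ?mulr1 ?mulr0 ?addr0 // addrC.
Qed.

(** * Bruhat cells *)

Section Bruhat.

Variables (K : fieldType) (n : nat).
Implicit Types (b M : 'M[K]_n) (w : 'S_n) (i : 'I_n.-1).

Definition bruhat_cell w M :=
  exists b b', [/\ borel b, borel b' & M = b *m weyl_mx K w *m b'].

Lemma elem_mx_unit (k l : 'I_n) (t : K) : k != l -> elem_mx k l t \in unitmx.
Proof.
move=> nkl; apply: (proj1 (mulmx1_unit (B := elem_mx k l (- t)) _)).
by rewrite elem_mxM // subrr /elem_mx scale0r addr0.
Qed.

Lemma borel_elem (k l : 'I_n) (t : K) : (k < l)%N -> borel (elem_mx k l t).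
Proof.
move=> ltkl; split; first by rewrite elem_mx_unit // -val_eqE /= ltn_eqF.
move=> i j ltji; rewrite !mxE (_ : (i == j) = false) ?add0r; last first.
  by rewrite -val_eqE /= gtn_eqF.
have [/andP[/eqP ei /eqP ej]|_] := boolP (_ && _); last exact: mulr0.
by rewrite ei ej ltnNge ltnW in ltji.
Qed.

Lemma weyl_mx_elem w (k l : 'I_n) (t : K) :
  elem_mx (w k) (w l) t *m weyl_mx K w = weyl_mx K w *m elem_mx k l t.
Proof.
apply/matrixP => i j; rewrite elem_mulmxE mulmx_elemE !weyl_mxE (inj_eq perm_inj).
by rewrite mulrC -mulrA [l == j]eq_sym mulrAC -mulrA.
Qed.

(** The rank one step of the Bruhat decomposition: [u B w B] lies in [B s_i w B]
    for a nontrivial lower elementary matrix [u] at the letter [i], provided that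
    [s_i w] is longer than [w].  The matrix [elem_mx hi lo t *m b] is upper
    triangular except for its nonzero entry at [(hi, lo)].  A column operation
    clears the entry at [(hi, hi)], and the exchange of the columns [lo] and [hi]
    then makes it upper triangular; the inverse column operation moves through
    [w] and remains upper triangular because [w^-1 lo < w^-1 hi]. *)
Lemma bruhat_step w i (t : K) M : t != 0 ->
    (w^-1 (ord_lo i) < w^-1 (ord_hi i))%g%N -> bruhat_cell w M ->
  bruhat_cell (w * simple_transp i)%g (elem_mx (ord_hi i) (ord_lo i) t *m M).
Proof.
move=> t0 ltw [b [b' [Bb Bb' ->]]].
have [bu b0] := Bb.
set lo := ord_lo i; set hi := ord_hi i.
have nhl : hi != lo by rewrite -val_eqE /= gtn_eqF.
pose m := elem_mx hi lo t *m b.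
have mE k l : m k l = b k l + (k == hi)%:R * (t * b lo l) by apply: elem_mulmxE.
have mlow (k l : 'I_n) : (l < k)%N -> ~~ ((k == hi) && (l == lo)) -> m k l = 0.
  move=> ltlk nkl; rewrite mE b0 // add0r.
  case: (k =P hi) nkl => [ek /= nl|]; rewrite ?mul0r //.
  rewrite b0 ?mulr0 //; move: ltlk; rewrite ek ltnS leq_eqVlt.
  by case/orP => // /eqP el; rewrite -val_eqE /= el eqxx in nl.
have mhl : m hi lo != 0.
  by rewrite mE b0 ?ltnS // eqxx add0r mul1r mulf_neq0 // borel_diag.
pose e := m hi hi / m hi lo.
pose si := weyl_mx K (simple_transp i).
have siK : si *m si = 1%:M.
  by rewrite -perm_mxM -invMg tperm2 invg1 perm_mx1.
pose b2 := m *m elem_mx lo hi (- e) *m si.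
have siE A k l : (A *m si) k l = A k (simple_transp i l).
  rewrite mxE (bigD1 (simple_transp i l)) //= big1 => [|h /negPf nh].
    by rewrite weyl_mxE eqxx mulr1 addr0.
  by rewrite weyl_mxE nh mulr0.
have Bb2 : borel b2.
  split.
    rewrite !unitmx_mul bu weyl_mx_unit !elem_mx_unit //.
    by rewrite eq_sym.
  move=> k l ltlk; rewrite siE mulmx_elemE /simple_transp.
  rewrite -/(ord_lo i) -/(ord_hi i) -/lo -/hi.
  case: tpermP => [el|el|/eqP nlo /eqP nhi].
  - rewrite eqxx mulr1; case: (eqVneq k hi) => [->|nk].
      by rewrite mulNr divfK ?subrr.
    rewrite !mlow ?mulr0 ?addr0 ?(negPf nk) //.
      by rewrite -el.
    rewrite el /= in ltlk; rewrite ltn_neqAle ltlk andbT.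
    by rewrite eq_sym val_eqE.
  - rewrite [lo == hi]eq_sym (negPf nhl) mulr0 addr0.
    rewrite el /= in ltlk; apply: mlow; first exact: ltnW.
    by rewrite -val_eqE /= gtn_eqF.
  - by rewrite (negPf nhi) mulr0 addr0 mlow // (negPf nlo) andbF.
exists b2, (elem_mx (w^-1 lo)%g (w^-1 hi)%g e *m b'); split=> //.
  by apply: borelM => //; apply: borel_elem.
rewrite -/lo -/hi !mulmxA -/m.
have -> : weyl_mx K (w * simple_transp i)%g = si *m weyl_mx K w.
  by rewrite /si /weyl_mx invMg perm_mxM.
rewrite /b2 !mulmxA -(mulmxA _ si si) siK mulmx1.
rewrite -(mulmxA _ (weyl_mx K w) (elem_mx _ _ _)) -weyl_mx_elem !permKV !mulmxA.
rewrite -(mulmxA m (elem_mx _ _ _)) elem_mxM 1?eq_sym // addNr.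
by rewrite /elem_mx scale0r addr0 mulmx1.
Qed.

(** The letters of [s] other than [i] preserve [0..i], so the inverse of their
    product sends [i] into [0..i] and [i+1] outside it: this is the length
    condition of [bruhat_step]. *)
Lemma word_mx_bruhat (t : 'I_n.-1 -> K) s : (forall i, t i != 0) -> uniq s ->
  bruhat_cell (word_perm s) (word_mx t s).
Proof.
move=> t0; elim: s => [_|i s IHs] /=.
  exists 1%:M, 1%:M; split; try exact: borel1.
  by rewrite mul1mx mulmx1 /weyl_mx invg1 perm_mx1.
case/andP=> nis us; apply: bruhat_step => //; last exact: IHs.
set w := word_perm s.
have lo : ((w^-1)%g (ord_lo i) <= i)%N.
  by rewrite -(word_perm_leq _ nis) permKV.
apply: leq_ltn_trans lo _; rewrite ltnNge -(word_perm_leq _ nis) permKV.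
by rewrite -ltnNge ltnSn.
Qed.

End Bruhat.

(** * The tangent cone *)

Section Equations.

Variables (K : fieldType) (n : nat).

(** The quadratic form [q] is 0 or [x_(j+1,j) * x_(i,j+1)], according to the order
    of the letters [j] and [j+1] in the word. *)
Lemma schubert_equation (s : seq 'I_n.-1) (p : lowpos n) :
    uniq s -> (forall i, i \in s) -> (1 < (val p).1 - (val p).2)%N ->
  exists2 q : coord_poly K n, q \is 2.-homog for mdeg &
    vanishes_on_schubert (word_perm s) ('X_(enum_rank p) - q).
Proof.
case: p => -[i j] /= ltji us sT gap.
have ltjjn : (j.+2 < n)%N.
  by apply: leq_ltn_trans (ltn_ord i); move: gap; rewrite ltn_subRL addn1.
have lt2i : (j.+1 < i)%N by move: gap; rewrite ltn_subRL addn1.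
pose p : lowpos n := exist _ (i, j) ltji.
have lta : (j < n.-1)%N by rewrite ltn_predRL ltnW.
have ltb : (j.+1 < n.-1)%N by rewrite ltn_predRL.
pose a : 'I_n.-1 := Ordinal lta; pose b : 'I_n.-1 := Ordinal ltb.
have ltk : (j.+1 < n.+1)%N by rewrite ltnS ltnW // ltnW.
have ltr : (j.+2 < n.+1)%N by rewrite ltnS ltnW.
pose k : 'I_n.+1 := Ordinal ltk; pose r : 'I_n.+1 := Ordinal ltr.
have [ltab|leba] := ltnP (index a s) (index b s).
  exists 0; first exact: rpred0.
  move=> y sy; rewrite subr0 /eval_coords mevalXU enum_rankK -chart_mx_low /=.
  have /(schubert_sub_std (k := k) (r := r))/(_ sy) :
      forall l : 'I_n, (l < k)%N -> (word_perm s l < r)%N.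
    move=> l; rewrite !ltnS => lel.
    by have [/(_ (leqnSn j) lel)] := word_perm_before l us (sT a) (sT b) ltab.
  move/(flag_of_sub _ _ _ (unitmx1 _ _))/(_ j i (ltnSn j) lt2i).
  by rewrite invmx1 mul1mx.
(* The two letters are distinct, so their places are distinct as well. *)
have ltba : (index b s < index a s)%N.
  rewrite ltn_neqAle leba andbT; apply/eqP => e.
  have := congr1 (nth a s) e; rewrite !nth_index // => /(congr1 val) /= /eqP.
  by rewrite gtn_eqF.
have ltjn : (j.+1 < n)%N by apply: ltnW.
pose j' : 'I_n := Ordinal ltjn.
pose p1 : lowpos n := exist _ (j', j) (ltnSn j).
pose p2 : lowpos n := exist _ (i, j') lt2i.
exists ('X_(enum_rank p1) * 'X_(enum_rank p2)).
  by apply: (@dhomogM _ _ _ 1 _ 1); rewrite dhomogX /= mdeg1.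
move=> y sy; rewrite /eval_coords mevalB mevalM !mevalXU !enum_rankK -!chart_mx_low /=.
apply/eqP; rewrite subr_eq0; apply/eqP.
apply: (@chart_std_sub _ _ y k r) => //; apply: schubert_std_sub sy => l.
rewrite !ltnS => lel.
by have [_ /(_ (leqnSn j) lel)] := word_perm_before l us (sT b) (sT a) ltba.
Qed.

End Equations.

Section Tangents.

Variables (K : numFieldType) (n : nat).

(** All parameters have to be nonzero for [t != 0], so that the curve stays in the
    Bruhat cell: the parameter of a vanishing coordinate of [x] is [t ^+ 2], which
    leaves the tangent vector unchanged. *)
Lemma tangent_curve (s : seq 'I_n.-1) (x : coords K n) :
    uniq s -> (forall i, i \in s) ->
    (forall p : lowpos n, (1 < (val p).1 - (val p).2)%N -> x p = 0) ->
  exists z : lowpos n -> {poly K}, (forall p, (z p)`_0 = x p) /\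
    forall t, t != 0 -> schubert (word_perm s) (chart [ffun p => ('X * z p).[t]]).
Proof.
move=> us sT x0.
pose pos (i : 'I_n.-1) : lowpos n := exist _ (ord_hi i, ord_lo i) (ltnSn i).
pose c i := (x (pos i))%:P + (x (pos i) == 0)%:R *: 'X.
have c0 i : (c i)`_0 = x (pos i).
  by rewrite coefD coefZ coefX mulr0 addr0 coefC.
pose M := word_mx (fun i => 'X * c i) s.
have [M0 M1] := word_mx_coef01 c s.
pose z (p : lowpos n) := drop_poly 1 (M (val p).1 (val p).2).
have zE p : 'X * z p = M (val p).1 (val p).2.
  apply/polyP => -[|d]; rewrite coefXM /=; last by rewrite coef_drop_poly addn1.
  by rewrite M0 -val_eqE /= gtn_eqF // (valP p).
exists z; split=> [p|t t0].
  rewrite coef_drop_poly M1.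
  have [gap|] := ltnP 1 ((val p).1 - (val p).2).
    rewrite x0 // big1 // => i /andP[/eqP ei /eqP ej].
    by move: gap; rewrite ei ej /= subSnn.
  rewrite leq_subLR addn1 => le1.
  have lt2 : ((val p).2 < n.-1)%N.
    by rewrite ltn_predRL; apply: leq_ltn_trans (valP p) _.
  pose i := Ordinal lt2.
  have pE : p = pos i.
    apply/val_inj; rewrite /= [LHS]surjective_pairing; congr (_, _); apply/val_inj => //=.
    by apply/eqP; rewrite eqn_leq le1; apply: (valP p).
  rewrite big_mkcond (bigD1_seq i) //= {1 2}pE /= !eqxx c0 -pE big1 ?addr0 // => l nli.
  rewrite pE /=; case: ifP => // /andP[_ /eqP e]; case/eqP: nli.
  by apply/val_inj; have /= := congr1 val e.
set y := finfun _.
have -> : chart y = flag_of (map_mx (horner_eval t) M).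
  congr flag_of; apply/matrixP => i j; rewrite [RHS]mxE /=.
  have [leij|ltji] := leqP i j.
    by rewrite chart_mx_up // /M word_mx_unitri // rmorph_nat.
  pose p : lowpos n := exist _ (i, j) ltji.
  by rewrite (chart_mx_low y p) ffunE zE.
have ct (i : 'I_n.-1) : horner_eval t ('X * c i) != 0.
  rewrite /horner_eval hornerM hornerX hornerD hornerC hornerZ hornerX.
  rewrite mulf_neq0 //; case: (x (pos i) =P 0) => [->|/eqP x1].
    by rewrite add0r mul1r.
  by rewrite mul0r addr0.
rewrite word_mx_map; have [b [b' [Bb Bb' ME]]] := word_mx_bruhat ct us.
exact: schubert_flag_of ME.
Qed.

End Tangents.

Lemma coxeter_word n (w : 'S_n) : is_coxeter w ->
  exists s, [/\ uniq s, forall i, i \in s & w = word_perm s].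
Proof.
case=> _ [s [s1 ->]]; exists s; split=> //; last by move=> i; rewrite -has_pred1 has_count s1.
by apply: count_mem_uniq => i; rewrite s1 -has_pred1 has_count s1.
Qed.

Theorem proposition5p3 (R : realType) (n : nat) (hn : (0 < n)%N)
    (w : 'S_n) (hw : is_coxeter w) (x : coords (complex R) n) :
  tangent_cone w x <->
  forall p : lowpos n, (1 < (val p).1 - (val p).2)%N -> x p = 0%R.
Proof.
have [s [us sT ->]] := coxeter_word hw; split=> [tx p gap|x0 p _ vp [d [-> _ plow]]].
  have [q hq vq] := schubert_equation (complex R) us sT gap.
  have := tx _ _ vq (lowest_form_linear _ hq).
  by rewrite /eval_coords mevalXU enum_rankK.
have [z [z0 zs]] := tangent_curve us sT x0.
have := @lowest_form_curve _ _ p d (fun k => z (enum_val k)) plow.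
rewrite /eval_coords => <-.
  by apply: meval_eq => k; rewrite z0.
move=> t /zs/vp <-; apply: meval_eq => k; by rewrite ffunE.
Qed.
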